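(* The function $\nu_p(n)$ (for integer arguments $n\ge 1$ and $p$ prime) can be represented by the arithmetic term $$\left\lfloor \frac{\gcd(n,p^n)^{n+1} \bmod (p^{n+1}\mathbin{\dot-}1)^2}{p^{n+1}\mathbin{\dot-}1}\right\rfloor ;$$ that is, for every integer $n\ge1$ and every prime $p$, $\nu_p(n)$ equals the value of this expression.
   Context: $\mathbb N=\{0,1,2,\dots\}$. $\nu_p(n)$ is the exponent of the prime $p$ in the prime factorization of $n$. Truncated subtraction: $x\mathbin{\dot-}y=\max(x-y,0)$. An arithmetic term in variables $n_1,\dots,n_r$ is an element of the smallest set of expressions containing $\mathbb N\cup\{n_1,\dots,n_r\}$ and closed under the binary operations $x+y$, $x\mathbin{\dot-}y$, $\lfloor x/y\rfloor$, $x^y$ on $\mathbb N$, with conventions $0^0=1$ and $\lfloor x/0\rfloor=0$. Products, remainders ($n\bmod m=n\mathbin{\dot-}(m\lfloor n/m\rfloor)$) and $\gcd$ are known to be expressible by arithmetic terms and are used as abbreviations; for positive $m,n$, $$\gcd(m,n)=\left\lfloor \frac{(2^{m^2n(n+1)}\mathbin{\dot-}2^{m^2n})(2^{m^2n^2}\mathbin{\dot-}1)}{(2^{m^2n}\mathbin{\dot-}1)(2^{mn^2}\mathbin{\dot-}1)2^{m^2n^2}}\right\rfloor\bmod 2^{mn}.$$ *)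

(* Defs.v *)
From mathcomp Require Import all_boot.

Set Implicit Arguments.
Unset Strict Implicit.
Unset Printing Implicit Defensive.

Inductive aterm (r : nat) : Type :=
| TCst of nat
| TVar of 'I_r
| TAdd of aterm r & aterm r
| TSub of aterm r & aterm r
| TDiv of aterm r & aterm r
| TExp of aterm r & aterm r.

Arguments TCst {r} _.
Arguments TVar {r} _.

Declare Scope aterm_scope.
Delimit Scope aterm_scope with AT.
Bind Scope aterm_scope with aterm.

Notation "t + u" := (TAdd t u) : aterm_scope.
Notation "t - u" := (TSub t u) : aterm_scope.
Notation "t %/ u" := (TDiv t u) : aterm_scope.
Notation "t ^ u" := (TExp t u) : aterm_scope.

(* On nat, [-] is truncated, [x %/ 0 = 0] and [0 ^ 0 = 1]. *)
Fixpoint eval (r : nat) (v : r.-tuple nat) (t : aterm r) : nat :=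
  match t with
  | TCst c => c
  | TVar i => tnth v i
  | TAdd t u => eval v t + eval v u
  | TSub t u => eval v t - eval v u
  | TDiv t u => eval v t %/ eval v u
  | TExp t u => eval v t ^ eval v u
  end.

(* Multiplication is not primitive: xy = ((x + y)^2 - (x^2 + y^2)) / 2. *)
Definition TMul (r : nat) (t u : aterm r) : aterm r :=
  (((t + u) ^ TCst 2 - (t ^ TCst 2 + u ^ TCst 2)) %/ TCst 2)%AT.

Notation "t * u" := (TMul t u) : aterm_scope.

Definition TMod (r : nat) (t u : aterm r) : aterm r :=
  (t - u * (t %/ u))%AT.

Notation "t %% u" := (TMod t u) : aterm_scope.

Lemma eval_TMul (r : nat) (v : r.-tuple nat) (t u : aterm r) :
  eval v (t * u)%AT = eval v t * eval v u.
Proof. by rewrite /= sqrnD addKn mulKn. Qed.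

Lemma eval_TMod (r : nat) (v : r.-tuple nat) (t u : aterm r) :
  eval v (t %% u)%AT = eval v t %% eval v u.
Proof.
transitivity (eval v t - eval v (u * (t %/ u))%AT); first by [].
by rewrite eval_TMul /= {1}(divn_eq (eval v t) (eval v u)) mulnC addKn.
Qed.

(* Mazzanti's formula; it computes the gcd only at positive arguments. *)
Definition TGcd (r : nat) (m n : aterm r) : aterm r :=
  let two := TCst 2 in
  let one := TCst 1 in
  ((((two ^ (m ^ two * n * (n + one)) - two ^ (m ^ two * n))
      * (two ^ (m ^ two * n ^ two) - one))
    %/ ((two ^ (m ^ two * n) - one)
        * (two ^ (m * n ^ two) - one)
        * two ^ (m ^ two * n ^ two)))
   %% two ^ (m * n))%AT.

Definition nu_term : aterm 2 :=
  let n := TVar ord0 in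
  let p := TVar ord_max in
  let one := TCst 1 in
  let q := (p ^ (n + one) - one)%AT in
  ((TGcd n (p ^ n) ^ (n + one) %% (q ^ TCst 2)) %/ q)%AT.

(* Main.v *)
Require Import Defs.
From mathcomp Require Import all_boot.

Set Implicit Arguments.
Unset Strict Implicit.
Unset Printing Implicit Defensive.

(** Write v for the p-adic valuation of n and q for p ^ (n + 1) - 1.  Since
    v < n, gcd(n, p ^ n) is p ^ v, and its (n + 1)-st power is
    (p ^ (n + 1)) ^ v = (1 + q) ^ v.  By the binomial theorem this is 1 + v q
    modulo q ^ 2 ([modn_exp_succ]), and because v < q that residue is already
    reduced; dividing it by q > 1 leaves v ([logn_gcdn_exp]).

    It remains to see that the term used for the gcd really computes it
    ([gcdn_mazzanti]).  Put b = 2 ^ (m n).  The two factors of the numerator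
    and the matching factors of the denominator form two geometric sums, so
    the integer quotient is that of
      sum over 1 <= i <= n and 0 <= j < m of b ^ (m i + n j)
    by b ^ (m n).  There are m n < b summands, hence no carries in base b
    ([digit_sum_exp]): the digit of this sum at position m n is the number of
    pairs (i, j) with m i + n j = m n.  These are the lattice points of a
    segment, one of its two ends left out, and there are gcd(m, n) of them
    ([card_lattice_segment]). *)

(** With fewer summands than the base, the summands below position K add up to
    less than b ^ K and those equal to b ^ K number less than b, so nothing is
    carried into or out of position K. *)
Lemma digit_sum_exp (T : finType) (e : T -> nat) (b K : nat) :
  #|T| < b ->
  (\sum_t b ^ e t) %/ b ^ K %% b = #|[set t | e t == K]|.
Proof.
move=> ltTb; have b_gt0 : 0 < b by apply: leq_ltn_trans ltTb.
rewrite (bigID (fun t => e t < K)) /=.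
rewrite [X in _ + X](bigID (fun t => e t == K)) /=.
set lo := \sum_(t | e t < K) _.
have -> : \sum_(t | ~~ (e t < K) && (e t == K)) b ^ e t
    = #|[set t | e t == K]| * b ^ K.
  rewrite -sum_nat_const; apply: eq_big => [t|t /andP[_ /eqP-> //]].
  by rewrite inE; case: eqP => [->|]; rewrite ?ltnn ?andbF.
have /dvdnP[c ->] :
    b ^ K.+1 %| \sum_(t | ~~ (e t < K) && (e t != K)) b ^ e t.
  apply: dvdn_sum => t /andP[geK neK]; apply: dvdn_exp2l.
  by rewrite ltn_neqAle eq_sym neK leqNgt.
have lo_lt : lo < b ^ K.
  case: K @lo => [|K] lo; first by rewrite /lo big_pred0.
  apply: (@leq_ltn_trans (#|T| * b ^ K)).
    rewrite -sum_nat_const /lo big_mkcond /=; apply: leq_sum => t _.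
    by case: ifP => // leK; apply: leq_pexp2l.
  by rewrite expnS ltn_pmul2r ?expn_gt0 ?b_gt0.
rewrite expnS mulnA -mulnDl addnC divnMDl ?expn_gt0 ?b_gt0 //.
rewrite divn_small // addn0 addnC modnMDl modn_small //.
by apply: leq_ltn_trans ltTb; apply: max_card.
Qed.

(** The pair (i, j) stands for the point (i + 1, j).  With g = gcd(m, n),
    m = g m' and n = g n', coprimality of m' and n' forces n' to divide the
    first coordinate of a solution, and the solutions are the points
    (n' k, m' (g - k)) with 1 <= k <= g. *)
Lemma card_lattice_segment (m n : nat) : 0 < m -> 0 < n ->
  #|[set t : 'I_n * 'I_m | m * t.1.+1 + n * t.2 == m * n]| = gcdn m n.
Proof.
move=> m_gt0 n_gt0; set g := gcdn m n.
have g_gt0 : 0 < g by rewrite gcdn_gt0 m_gt0.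
have /dvdnP[m' Em] : g %| m by apply: dvdn_gcdl.
have /dvdnP[n' En] : g %| n by apply: dvdn_gcdr.
have m'_gt0 : 0 < m' by move: m_gt0; rewrite Em muln_gt0 => /andP[].
have n'_gt0 : 0 < n' by move: n_gt0; rewrite En muln_gt0 => /andP[].
have co : coprime n' m'.
  rewrite coprime_sym /coprime -(eqn_pmul2r g_gt0) muln_gcdl -Em -En mul1n.
  by rewrite eqxx.
have lt1 (k : 'I_g) : (n' * k.+1).-1 < n.
  by rewrite prednK ?muln_gt0 ?n'_gt0 // En leq_pmul2l.
have lt2 (k : 'I_g) : m' * (g - k.+1) < m.
  by rewrite Em ltn_pmul2l // ltn_subrL g_gt0.
pose f k : 'I_n * 'I_m := (Ordinal (lt1 k), Ordinal (lt2 k)).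
have f_inj : injective f.
  move=> k l [] E1 _; apply/val_inj/eqP => /=.
  rewrite -eqSS -(eqn_pmul2l n'_gt0).
  by rewrite -[n' * k.+1]prednK ?muln_gt0 ?n'_gt0 // E1 prednK ?muln_gt0 ?n'_gt0.
rewrite -[RHS]card_ord -(card_imset predT f_inj).
apply: eq_card => -[i j]; rewrite inE /=; apply/eqP/imsetP => [E|[k _ [-> ->]]].
- have E' : m' * i.+1 + n' * j = m' * (n' * g).
    apply/eqP; rewrite -(eqn_pmul2l g_gt0) mulnDr !mulnA.
    by rewrite [g * m']mulnC [g * n']mulnC -Em -En -mulnA -En E.
  have /dvdnP[k Ek] : n' %| i.+1.
    rewrite -(Gauss_dvdr _ co) -(dvdn_addl _ (dvdn_mulr j (dvdnn n'))) E'.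
    by rewrite dvdn_mull ?dvdn_mulr.
  have k_gt0 : 0 < k by case: k Ek.
  have lekg : k <= g by rewrite -(leq_pmul2r n'_gt0) -Ek mulnC -En.
  have ltkg : k.-1 < g by rewrite prednK.
  exists (Ordinal ltkg) => //; congr (_, _); apply: val_inj => /=.
    by rewrite prednK // mulnC -Ek.
  rewrite prednK //; apply/eqP; rewrite -(eqn_pmul2l n'_gt0); apply/eqP.
  apply: (@addnI (m' * i.+1)); rewrite E' Ek [k * _]mulnC.
  by rewrite [n' * (m' * _)]mulnCA -!mulnDr subnKC.
- rewrite /= prednK ?muln_gt0 ?n'_gt0 // Em En.
  rewrite [n' * g * _]mulnCA -!mulnA [g * (n' * k.+1)]mulnCA -!mulnDr subnKC //.
  by rewrite [g * (n' * g)]mulnCA.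
Qed.

Lemma gcdn_mazzanti (m n : nat) : 0 < m -> 0 < n ->
  ((2 ^ (m ^ 2 * n * (n + 1)) - 2 ^ (m ^ 2 * n)) * (2 ^ (m ^ 2 * n ^ 2) - 1))
    %/ ((2 ^ (m ^ 2 * n) - 1) * (2 ^ (m * n ^ 2) - 1) * 2 ^ (m ^ 2 * n ^ 2))
    %% 2 ^ (m * n) = gcdn m n.
Proof.
move=> m_gt0 n_gt0; pose b := 2 ^ (m * n).
have EA : 2 ^ (m ^ 2 * n) = b ^ m by rewrite -expnM mulnAC mulnn.
have EB : 2 ^ (m * n ^ 2) = b ^ n by rewrite -expnM -mulnA mulnn.
have EAn : 2 ^ (m ^ 2 * n ^ 2) = b ^ (m * n) by rewrite -expnM mulnn expnMn.
rewrite addn1 (expnM 2 (m ^ 2 * n)) EA EB EAn -/b.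
have b_gt1 : 1 < b by rewrite (@ltn_exp2l 2 0) ?muln_gt0 ?m_gt0.
have gap k : 0 < k -> 0 < b ^ k - 1.
  by move=> k_gt0; rewrite subn_gt0 -[1](expn0 b) ltn_exp2l.
have -> : (b ^ m) ^ n.+1 - b ^ m
    = (b ^ m - 1) * \sum_(i < n) b ^ (m * i.+1).
  rewrite expnS -{3}[b ^ m]muln1 -mulnBr !subn1 predn_exp mulnCA big_distrr /=.
  by congr (_ * _); apply: eq_bigr => i _; rewrite -expnS -expnM.
have -> : b ^ (m * n) - 1 = (b ^ n - 1) * \sum_(j < m) b ^ (n * j).
  rewrite mulnC expnM !subn1 predn_exp.
  by congr (_ * _); apply: eq_bigr => j _; rewrite -expnM.
rewrite mulnACA divnMl ?muln_gt0 ?gap // big_distrlr /= pair_bigA /=.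
under eq_bigr do rewrite -expnD.
rewrite digit_sum_exp ?card_lattice_segment //.
by rewrite card_prod !card_ord mulnC ltn_expl.
Qed.

Lemma modn_exp_succ (q v : nat) : (1 + q) ^ v = 1 + v * q %[mod q ^ 2].
Proof.
elim: v => [|v IHv]; first by rewrite mul0n.
rewrite expnS -modnMmr IHv modnMmr.
have -> : (1 + q) * (1 + v * q) = v * q ^ 2 + (1 + v.+1 * q).
  rewrite mulnDl mul1n mulnDr muln1 mulnCA mulnn mulSn.
  by rewrite addnA addnC -[1 + v * q + q]addnA [v * q + q]addnC.
by rewrite modnMDl.
Qed.

Lemma gcdn_exp_logn (n p : nat) : 0 < n -> prime p ->
  gcdn n (p ^ n) = p ^ logn p n.
Proof.
move=> n_gt0 pr_p.
have /ltnW levn : logn p n < n by rewrite ltn_logl.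
have [u co En] := pfactor_coprime pr_p n_gt0.
rewrite {1}En -{2}(subnK levn) expnD -muln_gcdl.
by rewrite (eqP (_ : coprime u _)) ?mul1n // coprime_sym coprimeXl.
Qed.

Lemma logn_gcdn_exp (n p : nat) : 0 < n -> prime p ->
  logn p n =
    (gcdn n (p ^ n) ^ (n + 1) %% (p ^ (n + 1) - 1) ^ 2) %/ (p ^ (n + 1) - 1).
Proof.
move=> n_gt0 pr_p; rewrite gcdn_exp_logn // -expnM mulnC expnM.
set q := p ^ (n + 1) - 1; set v := logn p n.
have Eq : p ^ (n + 1) = 1 + q by rewrite subnKC // expn_gt0 prime_gt0.
have ltnq : n < q by rewrite ltn_subRL addnC ltn_expl ?prime_gt1.
have ltvq : v < q by apply: ltn_trans ltnq; apply: ltn_logl.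
have q_gt1 : 1 < q by apply: leq_ltn_trans ltnq.
rewrite Eq modn_exp_succ modn_small; last first.
  apply: (@leq_trans (v.+1 * q)); first by rewrite mulSn ltn_add2r.
  by rewrite -mulnn leq_mul2r ltvq orbT.
by rewrite addnC divnMDl ?divn_small ?addn0 // ltnW.
Qed.

Lemma eval_TGcd (r : nat) (v : r.-tuple nat) (t u : aterm r) :
  0 < eval v t -> 0 < eval v u ->
  eval v (TGcd t u) = gcdn (eval v t) (eval v u).
Proof.
move=> t_gt0 u_gt0; rewrite -gcdn_mazzanti //.
have evalD x y : eval v (x + y)%AT = eval v x + eval v y by [].
have evalB x y : eval v (x - y)%AT = eval v x - eval v y by [].
have evalV x y : eval v (x %/ y)%AT = eval v x %/ eval v y by [].
have evalX x y : eval v (x ^ y)%AT = eval v x ^ eval v y by [].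
have evalC c : eval v (TCst c) = c by [].
by rewrite /TGcd !(eval_TMod, eval_TMul, evalD, evalB, evalV, evalX, evalC).
Qed.

Theorem theorem2p1 (n p : nat) (hn : 0 < n) (hp : prime p) :
  logn p n = eval [tuple n; p] nu_term /\
  logn p n =
    (gcdn n (p ^ n) ^ (n + 1) %% (p ^ (n + 1) - 1) ^ 2) %/ (p ^ (n + 1) - 1).
Proof.
split; last exact: logn_gcdn_exp.
rewrite {1}logn_gcdn_exp //.
pose v := [tuple n; p].
have evalV x y : eval v (x %/ y)%AT = eval v x %/ eval v y by [].
have evalX x y : eval v (x ^ y)%AT = eval v x ^ eval v y by [].
rewrite /nu_term evalV eval_TMod evalX eval_TGcd //.
by rewrite /= expn_gt0 prime_gt0.
Qed.
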